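(* Let $A$ be a finite set and $B$ be a proper subset of $A$. Let $a$ be an element not in $A$ and let $b \in A \setminus B$. Then $$(A \cup \{a\})\,\Delta\,(B \cup \{a\})\approx (A\,\Delta\, B) \amalg (A \,\Delta\, (B\cup \{b\})).$$
   Context: A set $E$ is finite if $\mathcal{P}(E)$ is the only subset $\mathcal{S}$ of the power set $\mathcal{P}(E)$ such that $\varnothing \in \mathcal{S}$ and $F \cup \{e\} \in \mathcal{S}$ whenever $F \in \mathcal{S}$, $F \neq E$ and $e \in E \setminus F$ (this is equivalent to the usual notion of finiteness). For sets $E,F$ write $E \approx F$ if there exists a bijective mapping $E \to F$. For a finite set $A$ and $B \subset A$ let $A \,\Delta\, B = \{ C \in \mathcal{P}(A) : C \approx B\}$. For finite sets $A,B,C$ write $C \approx A \amalg B$ if there exist disjoint sets $A'$ and $B'$ with $A \approx A'$, $B \approx B'$ and $C \approx A' \cup B'$. *)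

(* Defs.v *)
From mathcomp Require Import all_boot.
From mathcomp Require Import boolp classical_sets functions cardinality.

Set Implicit Arguments.
Unset Strict Implicit.
Unset Printing Implicit Defensive.

Local Open Scope classical_set_scope.
Local Open Scope card_scope.

(* The relation "there is a bijection from E to F" is the library's [E #= F];
   the sets E and F may live in different types. *)

Definition subsets {T : Type} (E : set T) : set (set T) := [set F | F `<=` E].

(* [subsets E] always satisfies the two closure conditions, so "it is the only
   such S" amounts to "every such S equals it". *)
Definition inductively_finite {T : Type} (E : set T) : Prop :=
  forall S : set (set T),
    S `<=` subsets E ->
    S set0 ->
    (forall F e, S F -> F <> E -> (E `\` F) e -> S (F `|` [set e])) ->
    S = subsets E.

Definition delta {T : Type} (A B : set T) : set (set T) :=
  [set C | subsets A C /\ C #= B].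

(* The disjoint copies of A and B may be taken in any type. *)
Definition is_coproduct {TA TB TC : Type}
    (C : set TC) (A : set TA) (B : set TB) : Prop :=
  exists (U : Type) (A' B' : set U),
    [/\ A' `&` B' = set0, A #= A', B #= B' & C #= A' `|` B'].

Lemma inductively_finiteP (T : Type) (E : set T) :
  inductively_finite E <-> finite_set E.
Proof.
split=> [Efin|Efin S SE S0 SU].
  have : [set F | F `<=` E /\ finite_set F] = subsets E.
    apply: Efin => [F []|/=|F e [FE Ffin] _ [Ee _]] //=.
    - by split; [exact: sub0set | exact: finite_set0].
    - split; first by move=> x [/FE|->].
      by rewrite finite_setU; split=> //; exact: finite_set1.
  move/seteqP=> [_ /(_ E (@subset_refl _ E))] /= H.
  by have [] := H.
apply/seteqP; split=> // F FE.
have /(@finite_seqP {classic T})[s Fs] : finite_set F by exact: sub_finite_set Efin.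
move: FE; rewrite {}Fs; elim: s => [|x s IHs] sE; first by rewrite set_nil.
have {}IHs : S [set` s].
  by apply: IHs => y ys; apply: sE; rewrite /= inE (ys : y \in s) orbT.
have -> : [set` x :: s] = [set` s] `|` [set x].
  apply/seteqP; split=> y /=; rewrite inE.
    by case/orP=> [/eqP->|ys]; [right|left].
  by case=> [ys|->]; rewrite ?eqxx //; apply/orP; right.
have [xs|xs] := pselect ([set` s] x).
  by rewrite (_ : _ `|` _ = [set` s]) //; apply/setUidPl => y ->.
have Ex : E x by apply: sE; rewrite /= inE eqxx.
by apply: SU => // sEq; apply: xs; rewrite sEq.
Qed.

(* Main.v *)
Require Import Defs.
From mathcomp Require Import all_boot.
From mathcomp Require Import boolp classical_sets functions cardinality.
From HB Require Import structures.

Local Open Scope classical_set_scope.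
Local Open Scope card_scope.

(** This is Pascal's rule. Split the subsets of [A `|` [set a]] equipotent to
    [B `|` [set a]] according to whether they contain [a]. Those that do are the
    sets [D `|` [set a]] with [D] in [delta A B], and [D] is recovered from
    [D `|` [set a]] by removing [a], so there are as many of them as elements of
    [delta A B]. Those that do not are the subsets of [A] equipotent to
    [B `|` [set a]], that is, to [B `|` [set b]]. So the left-hand side is
    actually equal to the union of two disjoint copies of the summands.

    Both halves rest on the fact that adjoining one new point to each of two sets
    neither creates nor destroys equipotence ([card_eq_setU1]). *)

(** A map defined on the whole of [T] needs a value outside [X]; the point [u]
    provides it when [U] carries no structure. *)
Lemma card_eq_bijP (T U : Type) (u : U) (X : set T) (Y : set U) :
  X #= Y <-> exists f : T -> U, set_bij X Y f.
Proof.
pose U' : pointedType :=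
  HB.pack U (gen_eqMixin U) (gen_choiceMixin U) (isPointed.Build U u).
by split=> [/(@card_set_bijP T U')|H]; last apply/(@card_set_bijP T U').
Qed.

Lemma setU1D1 (T : Type) (X : set T) (x : T) :
  ~ X x -> (X `|` [set x]) `\ x = X.
Proof. by move=> Xx; rewrite setDUl setDv setU0 not_setD1. Qed.

Lemma card_eq_setU1_cong (T U : Type) (X : set T) (Y : set U) (x : T) (y : U) :
  ~ X x -> ~ Y y -> X #= Y -> X `|` [set x] #= Y `|` [set y].
Proof.
move=> Xx Yy /(card_eq_bijP _ _ y)[_ /Pbij[f _]].
have diff1 V (Z : set V) z : ~ Z z -> (Z `|` [set z]) `\` Z = [set z].
  by move=> Zz; rewrite setDUl setDv set0U setDidl//; apply/seteqP; split=> // _ [->].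
have [g _] : exists g : {bij (X `|` [set x]) >-> (Y `|` [set y])}, {in X, g =1 f}.
  apply: super_bij; [exact: subsetUl|exact: subsetUl|].
  by rewrite !diff1//; exact: eq_card1.
exact: (pcard_eq g).
Qed.

(** The common part [V `\ v `\ w] is completed by [w] on one side and by [v] on
    the other. *)
Lemma card_eq_setD1 (T : Type) (V : set T) (v w : T) :
  V v -> V w -> V `\ v #= V `\ w.
Proof.
move=> Vv Vw; have [->|vw] := pselect (v = w); first exact: card_eqxx.
have -> : V `\ v = V `\ v `\ w `|` [set w].
  by rewrite setUC setD1K//; split=> // /esym.
have -> : V `\ w = V `\ v `\ w `|` [set v].
  by rewrite setDDl [[set v] `|` _]setUC -setDDl setUC setD1K.
by apply: card_eq_setU1_cong => //; [case=> _; apply|case=> -[_ + _]; apply].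
Qed.

(** A bijection [f] between the extended sets need not send [x] to [y]: it only
    gives a bijection from [X] to the target without [f x], and exchanging the
    roles of [f x] and [y] in the target corrects this. *)
Lemma card_eq_setU1 (T U : Type) (X : set T) (Y : set U) (x : T) (y : U) :
  ~ X x -> ~ Y y -> (X `|` [set x] #= Y `|` [set y]) = (X #= Y).
Proof.
move=> Xx Yy; apply/idP/idP => [|]; last exact: card_eq_setU1_cong.
move=> /(card_eq_bijP _ _ y)[f fXY].
have Yfx : (Y `|` [set y]) (f x) by case: fXY => + _ _; apply; right.
have : X #= (Y `|` [set y]) `\ f x.
  apply/(card_eq_bijP _ _ y); exists f; rewrite -image_set1.
  by apply: bij_sub_setUll fXY; apply/disj_setPS => z [Xz zx]; apply: Xx; rewrite -zx.
move=> /card_eq_trans; apply; rewrite -[X in _ #= X](setU1D1 _ Y y)//.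
by apply: card_eq_setD1 => //; right.
Qed.

(** The first piece collects the sets that contain [a], the second those that
    avoid it; in the first, equipotence with [B `|` [set a]] descends to [B] by
    cancelling [a] on both sides. *)
Lemma delta_setU1 (T : Type) (A B : set T) (a : T) :
  ~ A a -> ~ B a ->
  delta (A `|` [set a]) (B `|` [set a]) =
  [set D `|` [set a] | D in delta A B] `|` delta A (B `|` [set a]).
Proof.
move=> Aa Ba; apply/seteqP; split=> [C [CA CB]|C [[D [DA DB] <-]|[CA CB]]].
- have [Ca|Ca] := pselect (C a); last first.
    by right; split=> // x Cx; have [//|xa] := CA x Cx; case: Ca; rewrite -xa.
  have CaU : C `\ a `|` [set a] = C by rewrite setUC setD1K.
  left; exists (C `\ a) => //; split; first by move=> x [/CA[]].
  by rewrite -(card_eq_setU1 _ _ _ _ a a) ?CaU//; case=> _; apply.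
- split; first by move=> x [/DA|]; [left|right].
  by rewrite card_eq_setU1// => /DA.
- by split=> // x /CA; left.
Qed.

(** Removing [a] inverts the adjunction of [a] on the subsets of [A]. *)
Lemma card_setU1_image (T : Type) (A : set T) (S : set (set T)) (a : T) :
  ~ A a -> S `<=` subsets A -> [set D `|` [set a] | D in S] #= S.
Proof.
move=> Aa SA; apply: inj_card_eq => D E /[!inE] /SA DA /SA EA DE.
by rewrite -(setU1D1 _ D a) ?DE ?setU1D1// => [/EA|/DA].
Qed.

Theorem theorem4p1 (T : Type) (A B : set T) (a b : T)
    (hA : inductively_finite A)
    (hB : B `<` A)
    (ha : ~ A a)
    (hb : (A `\` B) b) :
  is_coproduct (delta (A `|` [set a]) (B `|` [set a]))
               (delta A B)
               (delta A (B `|` [set b])).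
Proof.
have [_ Bb] := hb; have Ba : ~ B a by move=> /(properW hB).
have deltaba : delta A (B `|` [set b]) = delta A (B `|` [set a]).
  apply/seteqP; split=> C [CA CB]; split=> //; apply: card_eq_trans CB _;
    by rewrite card_eq_setU1.
exists (set T), [set D `|` [set a] | D in delta A B], (delta A (B `|` [set b])).
split.
- by apply/seteqP; split=> // _ [[D _ <-] [DA _]]; apply/ha/DA; right.
- by apply/card_esym/(card_setU1_image _ A) => // D [].
- exact: card_eqxx.
- by rewrite deltaba delta_setU1.
Qed.
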